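(* Let $a_1,a_2,b_1,b_2,c,t_1,t_2$ be complex numbers with $\Re(c)\neq 0,-1,\dots$, let $k_1,k_2\in\mathbb{N}$ (the value $0$ also being admitted), let $s$ be a positive integer, and let $|x|<1$, $|y|<1$. Write $\mathcal{F}^{(1)}_3=\mathcal{F}^{(1)}_3(a_1,a_2,b_1,b_2;c;t_1,t_2,k_1,k_2,x,y)$. Then the following recursion formulas hold true: $$\mathcal{F}^{(1)}_3(a_1+s,a_2,b_1,b_2;c;t_1,t_2,k_1,k_2,x,y)=\mathcal{F}^{(1)}_3+\frac{(-1)^{k_1}(-t_1)_{k_1}b_1x}{c}\sum_{r=1}^{s}\mathcal{F}^{(1)}_3(a_1+r,a_2,b_1+1,b_2;c+1;t_1-k_1,t_2,k_1,k_2,x,y);$$ $$\mathcal{F}^{(1)}_3(a_1-s,a_2,b_1,b_2;c;t_1,t_2,k_1,k_2,x,y)=\mathcal{F}^{(1)}_3-\frac{(-1)^{k_1}(-t_1)_{k_1}b_1x}{c}\sum_{r=0}^{s-1}\mathcal{F}^{(1)}_3(a_1-r,a_2,b_1+1,b_2;c+1;t_1-k_1,t_2,k_1,k_2,x,y);$$ $$\mathcal{F}^{(1)}_3(a_1,a_2+s,b_1,b_2;c;t_1,t_2,k_1,k_2,x,y)=\mathcal{F}^{(1)}_3+\frac{(-1)^{k_2}(-t_2)_{k_2}b_2y}{c}\sum_{r=1}^{s}\mathcal{F}^{(1)}_3(a_1,a_2+r,b_1,b_2+1;c+1;t_1,t_2-k_2,k_1,k_2,x,y);$$ $$\mathcal{F}^{(1)}_3(a_1,a_2-s,b_1,b_2;c;t_1,t_2,k_1,k_2,x,y)=\mathcal{F}^{(1)}_3-\frac{(-1)^{k_2}(-t_2)_{k_2}b_2y}{c}\sum_{r=0}^{s-1}\mathcal{F}^{(1)}_3(a_1,a_2-r,b_1,b_2+1;c+1;t_1,t_2-k_2,k_1,k_2,x,y);$$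 $$\mathcal{F}^{(1)}_3(a_1,a_2,b_1+s,b_2;c;t_1,t_2,k_1,k_2,x,y)=\mathcal{F}^{(1)}_3+\frac{(-1)^{k_1}(-t_1)_{k_1}a_1x}{c}\sum_{r=1}^{s}\mathcal{F}^{(1)}_3(a_1+1,a_2,b_1+r,b_2;c+1;t_1-k_1,t_2,k_1,k_2,x,y);$$ $$\mathcal{F}^{(1)}_3(a_1,a_2,b_1-s,b_2;c;t_1,t_2,k_1,k_2,x,y)=\mathcal{F}^{(1)}_3-\frac{(-1)^{k_1}(-t_1)_{k_1}a_1x}{c}\sum_{r=0}^{s-1}\mathcal{F}^{(1)}_3(a_1+1,a_2,b_1-r,b_2;c+1;t_1-k_1,t_2,k_1,k_2,x,y);$$ and, where also $\Re(c-s)\neq 0,-1,\dots$ so that the left side is defined, $$\begin{aligned}\mathcal{F}^{(1)}_3(a_1,a_2,b_1,b_2;c-s;t_1,t_2,k_1,k_2,x,y)&=\mathcal{F}^{(1)}_3\\&\quad+(-1)^{k_1}(-t_1)_{k_1}a_1b_1x\sum_{r=1}^{s}\frac{\mathcal{F}^{(1)}_3(a_1+1,a_2,b_1+1,b_2;c+2-r;t_1-k_1,t_2,k_1,k_2,x,y)}{(c-r)(c-r+1)}\\&\quad+(-1)^{k_2}(-t_2)_{k_2}a_2b_2y\sum_{r=1}^{s}\frac{\mathcal{F}^{(1)}_3(a_1,a_2+1,b_1,b_2+1;c+2-r;t_1,t_2-k_2,k_1,k_2,x,y)}{(c-r)(c-r+1)}.\end{aligned}$$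
   Context: $(z)_n=z(z+1)\cdots(z+n-1)$, $(z)_0=1$, is the Pochhammer symbol. The first discrete Appell function is the function defined by the double series $$\mathcal{F}^{(1)}_3(a_1,a_2,b_1,b_2;c;t_1,t_2,k_1,k_2,x,y)=\sum_{m,n\ge 0}\frac{(a_1)_m(a_2)_n(b_1)_m(b_2)_n(-1)^{mk_1}(-t_1)_{mk_1}(-1)^{nk_2}(-t_2)_{nk_2}}{(c)_{m+n}\,m!\,n!}\,x^m y^n,$$ which the paper asserts to converge absolutely for $|x|<1$, $|y|<1$ and arbitrary complex $t_1,t_2$; the denominator parameter $c$ is assumed to satisfy $\Re(c)\neq 0,-1,\dots$.
   Formalization: When k1>0 or k2>0, the double series for F and for the left side of each formula are assumed to converge absolutely: the asserted convergence for |x|,|y|<1 fails, e.g. a1=b1=c=1, a2=0, t1=-1, k1=1, k2=0 gives the divergent sum of (-1)^m m! x^m. *)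

(* Defs.v *)
From Stdlib Require Export Reals Factorial.
From Coquelicot Require Export Coquelicot.

Local Open Scope C_scope.

Fixpoint poch (z : C) (n : nat) : C :=
  match n with
  | O => RtoC 1
  | S p => poch z p * (z + INR p)
  end.

(* Like [Series], total: it is the sum of [u] when the series of real parts and
   the series of imaginary parts both converge. *)
Definition CSeries (u : nat -> C) : C :=
  (Series (fun n => Re (u n)), Series (fun n => Im (u n))).

(* For an absolutely convergent double series the iterated sum is the sum over
   all pairs, in any order. *)
Definition CSeries2 (u : nat -> nat -> C) : C :=
  CSeries (fun m => CSeries (fun n => u m n)).

Definition abs_summable2 (u : nat -> nat -> C) : Prop :=
  exists M : R, forall N : nat,
    (sum_n (fun m => sum_n (fun n => Cmod (u m n)) N) N <= M)%R.

Definition F3_term (a1 a2 b1 b2 c t1 t2 : C) (k1 k2 : nat) (x y : C)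
    (m n : nat) : C :=
  (poch a1 m * poch a2 n * poch b1 m * poch b2 n
   * RtoC (-1) ^ (m * k1) * poch (- t1) (m * k1)
   * RtoC (-1) ^ (n * k2) * poch (- t2) (n * k2))
  / (poch c (m + n) * INR (fact m) * INR (fact n))
  * x ^ m * y ^ n.

Definition F3 (a1 a2 b1 b2 c t1 t2 : C) (k1 k2 : nat) (x y : C) : C :=
  CSeries2 (F3_term a1 a2 b1 b2 c t1 t2 k1 k2 x y).

(* When k1 = k2 = 0 the series converges absolutely for all |x| < 1, |y| < 1.
   As soon as k1 > 0 (or k2 > 0) the factor (-t1)_{m k1} (or (-t2)_{n k2})
   grows like a factorial, and the series diverges for generic parameters
   however small x and y are; it converges for instance when it terminates. *)
Definition F3_abs_conv (a1 a2 b1 b2 c t1 t2 : C) (k1 k2 : nat) (x y : C)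
    : Prop :=
  abs_summable2 (F3_term a1 a2 b1 b2 c t1 t2 k1 k2 x y).

Definition Re_not_nonpos_int (c : C) : Prop :=
  forall j : nat, Re c <> (- INR j)%R.

(* Main.v *)
(** Raising [a1] by one changes [(a1)_m] by [m (a1 + 1)_(m - 1)], so the
    difference of the two series has no terms with [m = 0], and re-indexing
    [m] by one turns it into a multiple of the series with shifted parameters.
    Similarly [1 / (c)_N - 1 / (c + 1)_N = N / (c (c + 1)_N)], and splitting
    [N = m + n] produces the two sums of the last formula.  The formulas follow
    by telescoping; the remaining ones come from exchanging [a1] with [b1], or
    [m] with [n].

    Absolute convergence is needed at every intermediate parameter.  For
    [k1 = k2 = 0] it holds throughout; otherwise it is inherited from the
    endpoints, since [|(a + d)_m|] is bounded by a multiple of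
    [|(a)_m| + |(a + s)_m|] for [0 <= d <= s], and [1 / |(c + d)_N|] by a
    multiple of [1 / |(c)_N|].  The shifted series need no separate convergence
    hypothesis: they occur multiplied by a scalar, and either the scalar is
    zero or they inherit convergence from the re-indexed difference. *)

From Stdlib Require Import Lra Lia.
Require Import Defs.

Local Open Scope C_scope.

(** * Series of complex numbers *)

Lemma Series_null (u : nat -> R) : (forall n, u n = 0%R) -> Series u = 0%R.
Proof.
  intros H. rewrite (Series_ext u (fun n => 0 * u n)%R).
  - rewrite Series_scal_l. ring.
  - intros n. rewrite H. ring.
Qed.

Lemma CSeries_null (u : nat -> C) :
  (forall n, u n = RtoC 0) -> CSeries u = RtoC 0.
Proof.
  intros H. unfold CSeries.
  apply injective_projections; apply Series_null; intros n; now rewrite H.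
Qed.

Lemma CSeries_ext (u v : nat -> C) :
  (forall n, u n = v n) -> CSeries u = CSeries v.
Proof.
  intros H. unfold CSeries.
  f_equal; apply Series_ext; intros n; now rewrite H.
Qed.

Lemma CSeries2_ext (u v : nat -> nat -> C) :
  (forall m n, u m n = v m n) -> CSeries2 u = CSeries2 v.
Proof.
  intros H. apply CSeries_ext; intros m. apply CSeries_ext; intros n. apply H.
Qed.

Lemma im_le_Cmod (z : C) : (Rabs (Im z) <= Cmod z)%R.
Proof. eapply Rle_trans; [apply Rmax_r | apply Rmax_Cmod]. Qed.

Lemma Cmod_le_Re_Im (z : C) : (Cmod z <= Rabs (Re z) + Rabs (Im z))%R.
Proof.
  replace z with (RtoC (Re z) + Ci * RtoC (Im z)) at 1.
  - eapply Rle_trans; [apply Cmod_triangle |].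
    rewrite Cmod_mult, Cmod_Ci, !Cmod_R. lra.
  - destruct z. apply injective_projections; simpl; ring.
Qed.

Lemma ex_series_Rabs_le (u v : nat -> R) :
  (forall n, (Rabs (u n) <= v n)%R) -> ex_series v -> ex_series u.
Proof. exact (@ex_series_le R_AbsRing R_CompleteNormedModule u v). Qed.

Definition csummable (u : nat -> C) : Prop := ex_series (fun n => Cmod (u n)).

Lemma csummable_Re (u : nat -> C) :
  csummable u -> ex_series (fun n => Re (u n)).
Proof. apply ex_series_Rabs_le; intros n. apply re_le_Cmod. Qed.

Lemma csummable_Im (u : nat -> C) :
  csummable u -> ex_series (fun n => Im (u n)).
Proof. apply ex_series_Rabs_le; intros n. apply im_le_Cmod. Qed.

Lemma CSeries_plus (u v : nat -> C) :
  csummable u -> csummable v ->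
  CSeries (fun n => u n + v n) = CSeries u + CSeries v.
Proof.
  intros Hu Hv. apply injective_projections; simpl.
  - apply Series_plus; now apply csummable_Re.
  - apply Series_plus; now apply csummable_Im.
Qed.

Lemma CSeries_scal (k : C) (u : nat -> C) :
  csummable u -> CSeries (fun n => k * u n) = k * CSeries u.
Proof.
  intros Hu.
  pose proof (csummable_Re u Hu) as HR. pose proof (csummable_Im u Hu) as HI.
  assert (HS : forall (a : R) (w : nat -> R), ex_series w ->
            ex_series (fun n => a * w n)%R)
    by (intros a w Hw; exact (ex_series_scal_l a w Hw)).
  apply injective_projections; simpl.
  - rewrite <- !Series_scal_l. apply Series_minus; now apply HS.
  - rewrite <- !Series_scal_l. apply Series_plus; now apply HS.
Qed.

Lemma CSeries_shift (u : nat -> C) :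
  csummable u -> u O = RtoC 0 -> CSeries u = CSeries (fun n => u (S n)).
Proof.
  intros Hu H0. apply injective_projections; simpl.
  - rewrite Series_incr_1 by now apply csummable_Re.
    rewrite H0. simpl. ring.
  - rewrite Series_incr_1 by now apply csummable_Im.
    rewrite H0. simpl. ring.
Qed.

(** The factor 2 comes from bounding the real and the imaginary part separately, each by the series
    of moduli; only domination matters later. *)
Lemma Cmod_CSeries_le (u : nat -> C) :
  csummable u -> (Cmod (CSeries u) <= 2 * Series (fun n => Cmod (u n)))%R.
Proof.
  intros Hu. eapply Rle_trans; [apply Cmod_le_Re_Im |].
  assert (HA : forall f : C -> R, (forall z, (Rabs (f z) <= Cmod z)%R) ->
     (Rabs (Series (fun n => f (u n))) <= Series (fun n => Cmod (u n)))%R).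
  { intros f Hf. eapply Rle_trans.
    - apply Series_Rabs. apply ex_series_Rabs_le with (2 := Hu).
      intros n. rewrite Rabs_Rabsolu. apply Hf.
    - apply Series_le; [| exact Hu]. intros n; split; [apply Rabs_pos | apply Hf]. }
  pose proof (HA Re re_le_Cmod). pose proof (HA Im im_le_Cmod).
  unfold CSeries; simpl. lra.
Qed.

(** * Absolutely summable double series *)

Lemma sum_n_nonneg (f : nat -> R) (n : nat) :
  (forall k, (0 <= f k)%R) -> (0 <= sum_n f n)%R.
Proof.
  intros Hf. induction n as [|n IH].
  - rewrite sum_O. apply Hf.
  - rewrite sum_Sn. unfold plus; simpl. specialize (Hf (S n)). lra.
Qed.

Lemma sum_n_le_compat (f g : nat -> R) (n : nat) :
  (forall k, (f k <= g k)%R) -> (sum_n f n <= sum_n g n)%R.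
Proof. intros H. apply sum_n_m_le. exact H. Qed.

Lemma sum_n_mono (f : nat -> R) (n p : nat) :
  (forall k, (0 <= f k)%R) -> (n <= p)%nat -> (sum_n f n <= sum_n f p)%R.
Proof.
  intros Hf Hnp. induction Hnp as [|p Hnp IH]; [lra |].
  rewrite sum_Sn. unfold plus; simpl. specialize (Hf (S p)). lra.
Qed.

Lemma sum_n_term_le (f : nat -> R) (k n : nat) :
  (forall k, (0 <= f k)%R) -> (k <= n)%nat -> (f k <= sum_n f n)%R.
Proof.
  intros Hf Hk. eapply Rle_trans; [| now apply sum_n_mono with (n := k)].
  destruct k as [|k]; [rewrite sum_O; lra |].
  rewrite sum_Sn. unfold plus; simpl.
  pose proof (sum_n_nonneg f k Hf). lra.
Qed.

Lemma sum_n_succ_le (f : nat -> R) (n : nat) :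
  (forall k, (0 <= f k)%R) -> (sum_n (fun k => f (S k)) n <= sum_n f (S n))%R.
Proof.
  intros Hf. unfold sum_n. rewrite (sum_n_m_S f 0 n).
  rewrite (sum_Sn_m f O (S n)) by lia.
  unfold plus; simpl. specialize (Hf O). lra.
Qed.

Lemma ex_series_bounded (f : nat -> R) (M : R) :
  (forall k, (0 <= f k)%R) -> (forall n, (sum_n f n <= M)%R) -> ex_series f.
Proof.
  intros Hf HM.
  destruct (ex_finite_lim_seq_incr (sum_n f) M) as [l Hl].
  - intros n. apply sum_n_mono; [exact Hf | lia].
  - exact HM.
  - exists l. exact Hl.
Qed.

(** [abs_summable2] bounds square partial sums only. Every rectangle lies in the square of side
    [max m n], so the two sides may be enlarged independently of each other. *)
Lemma abs_summable2_rect (u : nat -> nat -> C) :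
  abs_summable2 u ->
  exists M, forall m n,
    (sum_n (fun i => sum_n (fun j => Cmod (u i j)) n) m <= M)%R.
Proof.
  intros [M HM]. exists M. intros m n.
  eapply Rle_trans; [| apply (HM (max m n))].
  assert (Hp : forall i p, (0 <= sum_n (fun j => Cmod (u i j)) p)%R)
    by (intros i p; apply sum_n_nonneg; intros; apply Cmod_ge_0).
  eapply Rle_trans.
  - apply sum_n_mono with (p := max m n); [intros i; apply Hp | lia].
  - apply sum_n_le_compat. intros i.
    apply sum_n_mono; [intros; apply Cmod_ge_0 | lia].
Qed.

Lemma abs_summable2_row (u : nat -> nat -> C) (m : nat) :
  abs_summable2 u -> csummable (u m).
Proof.
  intros Hu. destruct (abs_summable2_rect u Hu) as [M HM].
  apply ex_series_bounded with M; [intros; apply Cmod_ge_0 |].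
  intros n. eapply Rle_trans; [| apply (HM m n)].
  apply (sum_n_term_le (fun i => sum_n (fun j => Cmod (u i j)) n));
    [intros i; apply sum_n_nonneg; intros; apply Cmod_ge_0 | lia].
Qed.

(** With the number of rows fixed, letting the width of the rectangles tend to infinity keeps the
    bound [M]. Hence the partial sums of the row sums of moduli are at most [M], and
    [Cmod_CSeries_le] passes this on to the row sums themselves. *)
Lemma abs_summable2_rows (u : nat -> nat -> C) :
  abs_summable2 u -> csummable (fun m => CSeries (u m)).
Proof.
  intros Hu. destruct (abs_summable2_rect u Hu) as [M HM].
  pose proof (fun m => abs_summable2_row u m Hu) as Hrow.
  assert (Hpos : forall m, (0 <= Series (fun n => Cmod (u m n)))%R).
  { intros m. rewrite <- (Series_null (fun _ => 0%R)) by reflexivity.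
    apply Series_le; [| apply Hrow].
    intros n; split; [lra | apply Cmod_ge_0]. }
  assert (Hlim : forall m, is_lim_seq
      (fun n => sum_n (fun i => sum_n (fun j => Cmod (u i j)) n) m)
      (sum_n (fun i => Series (fun n => Cmod (u i n))) m)).
  { assert (H1 : forall i, is_lim_seq (sum_n (fun j => Cmod (u i j)))
        (Series (fun n => Cmod (u i n))))
      by (intros i; exact (Series_correct _ (Hrow i))).
    (* A limit in the width commutes with the finite sum over rows. *)
    intros m. induction m as [|m IH].
    - rewrite sum_O. eapply is_lim_seq_ext; [| apply H1].
      intros n. now rewrite sum_O.
    - rewrite sum_Sn.
      eapply is_lim_seq_ext; [| apply is_lim_seq_plus' with (1 := IH) (2 := H1 (S m))].
      intros n. now rewrite sum_Sn. }
  assert (HS : ex_series (fun m => Series (fun n => Cmod (u m n)))).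
  { apply ex_series_bounded with M; [exact Hpos |].
    intros m.
    exact (is_lim_seq_le _ _ _ _ (HM m) (Hlim m) (is_lim_seq_const M)). }
  apply (ex_series_Rabs_le _ (fun m => 2 * Series (fun n => Cmod (u m n)))%R).
  - intros m. rewrite Rabs_pos_eq by apply Cmod_ge_0. now apply Cmod_CSeries_le.
  - exact (ex_series_scal_l 2%R _ HS).
Qed.

Lemma CSeries2_plus (u v : nat -> nat -> C) :
  abs_summable2 u -> abs_summable2 v ->
  CSeries2 (fun m n => u m n + v m n) = CSeries2 u + CSeries2 v.
Proof.
  intros Hu Hv. unfold CSeries2.
  rewrite <- CSeries_plus by now apply abs_summable2_rows.
  apply CSeries_ext; intros m.
  apply CSeries_plus; now apply abs_summable2_row.
Qed.

Lemma abs_summable2_dominated (u v : nat -> nat -> C) (K : R) :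
  (forall m n, (Cmod (u m n) <= K * Cmod (v m n))%R) ->
  abs_summable2 v -> abs_summable2 u.
Proof.
  (* The sign of [K] is unspecified, so [Rabs K] takes its place when the bound [M] is
     multiplied. *)
  intros H [M HM]. exists (Rabs K * M)%R. intros N.
  assert (HH : forall m n, (Cmod (u m n) <= Rabs K * Cmod (v m n))%R).
  { intros m n. eapply Rle_trans; [apply H |].
    apply Rmult_le_compat_r; [apply Cmod_ge_0 | apply Rle_abs]. }
  eapply Rle_trans;
    [| apply Rmult_le_compat_l; [apply Rabs_pos | apply (HM N)]].
  rewrite <- (sum_n_mult_l (K := R_Ring) (Rabs K)).
  apply sum_n_le_compat; intros m.
  rewrite <- (sum_n_mult_l (K := R_Ring) (Rabs K)).
  apply sum_n_le_compat; intros n. apply HH.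
Qed.

Lemma abs_summable2_plus (u v : nat -> nat -> C) :
  abs_summable2 u -> abs_summable2 v ->
  abs_summable2 (fun m n => u m n + v m n).
Proof.
  intros [M HM] [M' HM']. exists (M + M')%R. intros N.
  eapply Rle_trans; [| apply Rplus_le_compat; [apply HM | apply HM']].
  rewrite <- (sum_n_plus (G := R_AbelianMonoid)).
  apply sum_n_le_compat; intros m.
  rewrite <- (sum_n_plus (G := R_AbelianMonoid)).
  apply sum_n_le_compat; intros n. apply Cmod_triangle.
Qed.

Lemma abs_summable2_scal (k : C) (u : nat -> nat -> C) :
  abs_summable2 u -> abs_summable2 (fun m n => k * u m n).
Proof.
  apply abs_summable2_dominated with (K := Cmod k).
  intros m n. rewrite Cmod_mult. lra.
Qed.

Lemma abs_summable2_minus (u v : nat -> nat -> C) :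
  abs_summable2 u -> abs_summable2 v ->
  abs_summable2 (fun m n => u m n - v m n).
Proof.
  intros Hu Hv.
  apply (abs_summable2_plus u (fun m n => - v m n) Hu).
  apply (abs_summable2_dominated _ v 1%R); [| exact Hv].
  intros m n. rewrite Cmod_opp. lra.
Qed.

(** Intended for a term split into the Pochhammer factor of one parameter ([p], [q], [r] at three
    values of it) and the common remainder [w]. *)
Lemma abs_summable2_factor (p q r : nat -> nat -> C) (w : nat -> nat -> C) (K : R) :
  (forall m n, (Cmod (p m n) <= K * (Cmod (q m n) + Cmod (r m n)))%R) ->
  abs_summable2 (fun m n => q m n * w m n) ->
  abs_summable2 (fun m n => r m n * w m n) ->
  abs_summable2 (fun m n => p m n * w m n).
Proof.
  intros H Hq Hr.
  (* The comparison series is the sum of the moduli, because [q * w + r * w] could cancel. *)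
  assert (Hmod : forall v : nat -> nat -> C, abs_summable2 v ->
            abs_summable2 (fun m n => RtoC (Cmod (v m n)))).
  { intros v. apply abs_summable2_dominated with (K := 1%R).
    intros m n. rewrite Cmod_R, Rabs_pos_eq by apply Cmod_ge_0. lra. }
  refine (abs_summable2_dominated _ _ K _
            (abs_summable2_plus _ _ (Hmod _ Hq) (Hmod _ Hr))).
  intros m n. rewrite <- RtoC_plus, Cmod_R, Rabs_pos_eq.
  - rewrite !Cmod_mult.
    pose proof (Rmult_le_compat_r _ _ _ (Cmod_ge_0 (w m n)) (H m n)). lra.
  - pose proof (Cmod_ge_0 (q m n * w m n)).
    pose proof (Cmod_ge_0 (r m n * w m n)). lra.
Qed.

Lemma abs_summable2_shift_l (u : nat -> nat -> C) :
  abs_summable2 u -> abs_summable2 (fun m n => u (S m) n).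
Proof.
  intros Hu. destruct (abs_summable2_rect u Hu) as [M HM].
  exists M. intros N. eapply Rle_trans; [| apply (HM (S N) N)].
  apply (sum_n_succ_le (fun i => sum_n (fun j => Cmod (u i j)) N)).
  intros i; apply sum_n_nonneg; intros; apply Cmod_ge_0.
Qed.

Lemma abs_summable2_shift_r (u : nat -> nat -> C) :
  abs_summable2 u -> abs_summable2 (fun m n => u m (S n)).
Proof.
  intros Hu. destruct (abs_summable2_rect u Hu) as [M HM].
  exists M. intros N. eapply Rle_trans; [| apply (HM N (S N))].
  apply sum_n_le_compat; intros i.
  apply (sum_n_succ_le (fun j => Cmod (u i j))). intros; apply Cmod_ge_0.
Qed.

(* For [k <> 0] summability passes from [k * u] to [u]; for [k = 0] both sides
   vanish, whatever value [CSeries2 u] takes. *)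
Lemma CSeries2_scal (k : C) (u : nat -> nat -> C) :
  abs_summable2 (fun m n => k * u m n) ->
  CSeries2 (fun m n => k * u m n) = k * CSeries2 u.
Proof.
  intros H. destruct (Ceq_dec k 0) as [-> | Hk].
  - rewrite Cmult_0_l.
    apply CSeries_null; intros m. apply CSeries_null; intros n. ring.
  - assert (Hu : abs_summable2 u).
    { refine (abs_summable2_dominated _ _ 1%R _ (abs_summable2_scal (/ k) _ H)).
      intros m n. replace (/ k * (k * u m n)) with (u m n) by (field; exact Hk). lra. }
    transitivity (CSeries (fun m => k * CSeries (u m))).
    + apply CSeries_ext; intros m. apply CSeries_scal. now apply abs_summable2_row.
    + apply CSeries_scal. now apply abs_summable2_rows.
Qed.

(** The row [m = 0] contributes nothing, and the remaining rows are those of [k * v]. Summability of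
    [k * v] is that of the shifted [u], which is what [CSeries2_scal] asks for. *)
Lemma CSeries2_shift_l (k : C) (u v : nat -> nat -> C) :
  abs_summable2 u ->
  (forall n, u O n = RtoC 0) -> (forall m n, u (S m) n = k * v m n) ->
  CSeries2 u = k * CSeries2 v.
Proof.
  intros Hu H0 HS. rewrite <- CSeries2_scal.
  - unfold CSeries2. rewrite CSeries_shift.
    + apply CSeries_ext; intros m. apply CSeries_ext; intros n. apply HS.
    + now apply abs_summable2_rows.
    + apply CSeries_null, H0.
  - apply (abs_summable2_dominated _ (fun m n => u (S m) n) 1%R).
    + intros m n. rewrite HS. lra.
    + now apply abs_summable2_shift_l.
Qed.

Lemma CSeries2_shift_r (k : C) (u v : nat -> nat -> C) :
  abs_summable2 u ->
  (forall m, u m O = RtoC 0) -> (forall m n, u m (S n) = k * v m n) ->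
  CSeries2 u = k * CSeries2 v.
Proof.
  intros Hu H0 HS. rewrite <- CSeries2_scal.
  - unfold CSeries2. apply CSeries_ext; intros m. rewrite CSeries_shift.
    + apply CSeries_ext; intros n. apply HS.
    + now apply abs_summable2_row.
    + apply H0.
  - apply (abs_summable2_dominated _ (fun m n => u m (S n)) 1%R).
    + intros m n. rewrite HS. lra.
    + now apply abs_summable2_shift_r.
Qed.

(** * Pochhammer symbols: splitting, zeros and comparison under integer shifts *)

Lemma poch_add (z : C) (m n : nat) :
  poch z (m + n) = poch z m * poch (z + INR m) n.
Proof.
  induction n as [|n IH].
  - rewrite Nat.add_0_r. simpl. ring.
  - rewrite Nat.add_succ_r. cbn [poch]. rewrite IH, plus_INR, RtoC_plus. ring.
Qed.

Lemma poch_S_l (z : C) (n : nat) : poch z (S n) = z * poch (z + 1) n.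
Proof.
  change (S n) with (1 + n)%nat. rewrite poch_add. cbn [poch INR]. ring.
Qed.

(** Both sides split [poch z (d + m)]. A shift of the parameter by [d] is thereby traded for the
    product [poch (z + INR m) d], whose number of factors does not depend on [m]. *)
Lemma poch_shift (z : C) (d m : nat) :
  poch z d * poch (z + INR d) m = poch z m * poch (z + INR m) d.
Proof. rewrite <- !poch_add. f_equal. lia. Qed.

Lemma poch_eq_0 (z : C) (n : nat) :
  poch z n = RtoC 0 <-> exists j, (j < n)%nat /\ z = - INR j.
Proof.
  split.
  - induction n as [|n IH]; cbn [poch]; intros H.
    + injection H; lra.
    + destruct (Ceq_dec (poch z n) 0) as [H0 | H0].
      * destruct (IH H0) as [j [Hj Hz]]. exists j; split; [lia | exact Hz].
      * exists n; split; [lia |].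
        assert (H1 : z + INR n = RtoC 0).
        { replace (z + INR n) with (/ poch z n * (poch z n * (z + INR n)))
            by (field; exact H0).
          rewrite H. ring. }
        replace z with (z + INR n - INR n) by ring. rewrite H1. ring.
  - intros [j [Hj Hz]].
    (* The last of the first [S j] factors is [z + INR j], which vanishes. *)
    replace n with (S j + (n - S j))%nat by lia.
    rewrite poch_add. cbn [poch]. rewrite Hz at 2. ring.
Qed.

Lemma poch_neq_0 (z : C) (n : nat) : Re_not_nonpos_int z -> poch z n <> RtoC 0.
Proof.
  intros Hz H. apply poch_eq_0 in H. destruct H as [j [_ Hj]].
  apply (Hz j). rewrite Hj. simpl. ring.
Qed.

Lemma Cmod_add_INR_lower (z : C) (n : nat) : (INR n - Cmod z <= Cmod (z + INR n))%R.
Proof.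
  pose proof (Cmod_triangle (z + INR n) (- z)) as H.
  replace (z + INR n + - z) with (RtoC (INR n)) in H by ring.
  rewrite Cmod_R, Rabs_pos_eq, Cmod_opp in H by apply pos_INR. lra.
Qed.

Lemma Cmod_add_INR_upper (z : C) (n : nat) : (Cmod (z + INR n) <= Cmod z + INR n)%R.
Proof.
  eapply Rle_trans; [apply Cmod_triangle |].
  rewrite Cmod_R, Rabs_pos_eq by apply pos_INR. lra.
Qed.

(** Once [m] exceeds [Cmod z + 1], each factor [z + m + i] has modulus at least [m + i - Cmod z],
    hence at least 1. *)
Lemma poch_eventually_ge_1 (z : C) (d : nat) :
  exists J, forall m, (J <= m)%nat -> (1 <= Cmod (poch (z + INR m) d))%R.
Proof.
  destruct (INR_unbounded (Cmod z + 1)) as [J HJ]. exists J. intros m Hm.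
  induction d as [|d IH]; cbn [poch].
  - rewrite Cmod_1. lra.
  - rewrite Cmod_mult.
    replace (z + INR m + INR d) with (z + INR (m + d)%nat)
      by (rewrite plus_INR, RtoC_plus; ring).
    pose proof (Cmod_add_INR_lower z (m + d)).
    assert (INR J <= INR (m + d))%R by (apply le_INR; lia).
    rewrite <- (Rmult_1_r 1). apply Rmult_le_compat; lra.
Qed.

(** Only finitely many indices lie below [J], and for them the sum of the quotients [f m / g m]
    serves as constant. *)
Lemma dominated_of_eventually (f g : nat -> R) (K : R) (J : nat) :
  (forall m, (0 <= f m)%R) -> (forall m, (0 <= g m)%R) ->
  (forall m, g m = 0%R -> f m = 0%R) ->
  (forall m, (J <= m)%nat -> (f m <= K * g m)%R) ->
  exists K', (0 <= K')%R /\ forall m, (f m <= K' * g m)%R.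
Proof.
  intros Hf Hg H0 HK.
  assert (Hfin : exists K1, (0 <= K1)%R /\
            forall m, (m < J)%nat -> (f m <= K1 * g m)%R).
  { clear HK. induction J as [|J [K1 [HK1 IH]]].
    - exists 0%R. split; [lra | intros; lia].
    (* If [g J = 0] then [f J = 0] as well, so the added quotient is 0 and the bound at [J] still
       holds. *)
    - exists (K1 + f J / g J)%R.
      assert (Hq : (0 <= f J / g J)%R).
      { destruct (Req_dec (g J) 0) as [E | E].
        - rewrite (H0 J E). unfold Rdiv. lra.
        - apply Rdiv_le_0_compat; [apply Hf | specialize (Hg J); lra]. }
      split; [lra |]. intros m Hm. specialize (Hg m).
      destruct (Nat.eq_dec m J) as [-> | Hne].
      + destruct (Req_dec (g J) 0) as [E | E].
        * rewrite (H0 J E), E. lra.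
        * assert (f J / g J * g J = f J)%R by (field; exact E). nra.
      + specialize (IH m ltac:(lia)). nra. }
  destruct Hfin as [K1 [HK1 HK1']].
  exists (K1 + Rabs K)%R. pose proof (Rabs_pos K). pose proof (Rle_abs K).
  split; [lra |]. intros m. specialize (Hg m).
  destruct (Nat.le_gt_cases J m) as [Hm | Hm].
  - specialize (HK m Hm). nra.
  - specialize (HK1' m Hm). nra.
Qed.

(* For large [m] the factor [(a + d)_(s - d)] relating [(a + d)_m] to
   [(a + s)_m] has modulus at least 1.  For the remaining [m], if [(a)_m] and
   [(a + s)_m] both vanish then [-a] and [-(a + s)] are natural numbers below
   [m], hence so is [-(a + d)]. *)
Lemma poch_between (a : C) (d s : nat) :
  (d <= s)%nat ->
  exists K, forall m,
    (Cmod (poch (a + INR d) m)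
     <= K * (Cmod (poch a m) + Cmod (poch (a + INR s) m)))%R.
Proof.
  intros Hds.
  set (e := (s - d)%nat).
  assert (He : a + INR s = a + INR d + INR e).
  { unfold e. rewrite minus_INR, RtoC_minus by exact Hds. ring. }
  destruct (poch_eventually_ge_1 (a + INR d) e) as [J HJ].
  destruct (dominated_of_eventually
     (fun m => Cmod (poch (a + INR d) m))
     (fun m => Cmod (poch a m) + Cmod (poch (a + INR s) m))%R
     (Cmod (poch (a + INR d) e)) J) as [K [_ HK]].
  - intros m; apply Cmod_ge_0.
  - intros m. pose proof (Cmod_ge_0 (poch a m)).
    pose proof (Cmod_ge_0 (poch (a + INR s) m)). lra.
  - intros m H. pose proof (Cmod_ge_0 (poch a m)) as Ha.
    pose proof (Cmod_ge_0 (poch (a + INR s) m)) as Hs.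
    assert (E1 : poch a m = RtoC 0) by (apply Cmod_eq_0; lra).
    assert (E2 : poch (a + INR s) m = RtoC 0) by (apply Cmod_eq_0; lra).
    apply poch_eq_0 in E1; apply poch_eq_0 in E2.
    destruct E1 as [i [Hi Ei]]; destruct E2 as [j [Hj Ej]].
    assert (Eij : INR i = INR (j + s)).
    { rewrite Ei in Ej. apply (f_equal Re) in Ej. simpl in Ej.
      rewrite plus_INR. lra. }
    apply INR_eq in Eij.
    replace (poch (a + INR d) m) with (RtoC 0); [apply Cmod_0 |].
    (* The subtraction is not truncated: [i = j + s] and [d <= s]. *)
    symmetry. apply poch_eq_0. exists (i - d)%nat. split; [lia |].
    rewrite Ei, minus_INR, RtoC_minus by lia. ring.
  - intros m Hm. specialize (HJ m Hm).
    pose proof (f_equal Cmod (poch_shift (a + INR d) e m)) as E.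
    rewrite <- He, !Cmod_mult in E.
    pose proof (Cmod_ge_0 (poch a m)).
    pose proof (Cmod_ge_0 (poch (a + INR d) m)).
    pose proof (Cmod_ge_0 (poch (a + INR d) e)). nra.
  - exists K. exact HK.
Qed.

(** By [poch_shift], the quotient of [poch c m] by [poch (c + INR e) m] is
    [poch c e / poch (c + INR m) e], whose denominator has modulus at least 1 for large [m]. The
    finitely many other [m] cause no trouble, since no Pochhammer symbol here vanishes. *)
Lemma poch_inv_between (c : C) (e : nat) :
  Re_not_nonpos_int c -> Re_not_nonpos_int (c + INR e) ->
  exists K, forall m,
    (Cmod (/ poch (c + INR e) m) <= K * Cmod (/ poch c m))%R.
Proof.
  intros Hc Hce.
  destruct (poch_eventually_ge_1 c e) as [J HJ].
  destruct (dominated_of_eventually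
     (fun m => Cmod (/ poch (c + INR e) m)) (fun m => Cmod (/ poch c m))
     (Cmod (poch c e)) J) as [K [_ HK]].
  - intros m; apply Cmod_ge_0.
  - intros m; apply Cmod_ge_0.
  - intros m H. rewrite Cmod_inv in H by now apply poch_neq_0.
    exfalso. apply (Rinv_neq_0_compat (Cmod (poch c m))); [| exact H].
    intros E. apply Cmod_eq_0 in E. now apply poch_neq_0 in E.
  - intros m Hm. specialize (HJ m Hm).
    pose proof (poch_neq_0 c m Hc) as N1. pose proof (poch_neq_0 _ m Hce) as N2.
    pose proof (f_equal Cmod (poch_shift c e m)) as E.
    rewrite !Cmod_mult in E.
    rewrite !Cmod_inv by assumption.
    apply Cmod_gt_0 in N1; apply Cmod_gt_0 in N2.
    apply Rmult_le_reg_l with (Cmod (poch (c + INR e) m)); [exact N2 |].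
    rewrite Rinv_r by lra.
    replace (Cmod (poch (c + INR e) m) * (Cmod (poch c e) * / Cmod (poch c m)))%R
      with (Cmod (poch c e) * Cmod (poch (c + INR e) m) / Cmod (poch c m))%R
      by (unfold Rdiv; ring).
    rewrite E.
    replace (Cmod (poch c m) * Cmod (poch (c + INR m) e) / Cmod (poch c m))%R
      with (Cmod (poch (c + INR m) e)) by (field; lra).
    exact HJ.
  - exists K. exact HK.
Qed.

(** * Growth of Pochhammer symbols and convergence for [k1 = k2 = 0] *)

(** The hypothesis says, cross-multiplied so that [f] may vanish, that [f / g] does not increase
    from [J] on; it then stays below [f J / g J]. *)
Lemma dominated_of_ratio (f g : nat -> R) (J : nat) :
  (forall m, (0 <= f m)%R) -> (forall m, (0 < g m)%R) ->
  (forall m, (J <= m)%nat -> (f (S m) * g m <= f m * g (S m))%R) ->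
  exists K, (0 <= K)%R /\ forall m, (f m <= K * g m)%R.
Proof.
  intros Hf Hg H.
  apply (dominated_of_eventually f g (f J / g J) J).
  - exact Hf.
  - intros m; apply Rlt_le, Hg.
  - intros m E. specialize (Hg m). lra.
  - intros m Hm. induction Hm as [|m Hm IH].
    + right. field. specialize (Hg J). lra.
    + specialize (H m Hm). pose proof (Hg m). pose proof (Hg (S m)).
      apply Rmult_le_reg_r with (g m); [lra |].
      eapply Rle_trans; [exact H |].
      replace (f J / g J * g (S m) * g m)%R with (f J / g J * g m * g (S m))%R by ring.
      apply Rmult_le_compat_r; lra.
Qed.

Lemma INR_fact_S (n : nat) : INR (fact (S n)) = (INR (S n) * INR (fact n))%R.
Proof. rewrite <- mult_INR. reflexivity. Qed.

(** The ratio of consecutive values of [Cmod (poch z m) / m!] is [Cmod (z + INR m) / (m + 1)], which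
    tends to 1 and so is eventually at most [rho]. *)
Lemma poch_upper (z : C) (rho : R) :
  (1 < rho)%R ->
  exists K, (0 <= K)%R /\
    forall m, (Cmod (poch z m) <= K * (rho ^ m * INR (fact m)))%R.
Proof.
  intros Hr.
  (* For [m >= J] this choice gives [Cmod z + m <= rho * m]. *)
  destruct (INR_archimed (rho - 1) (Cmod z) ltac:(lra)) as [J HJ].
  apply (dominated_of_ratio (fun m => Cmod (poch z m)) _ J).
  - intros m; apply Cmod_ge_0.
  - intros m. apply Rmult_lt_0_compat; [apply pow_lt; lra | apply INR_fact_lt_0].
  - intros m Hm. cbn [poch pow]. rewrite Cmod_mult, INR_fact_S.
    assert (Hle : (Cmod (z + INR m) <= rho * INR (S m))%R).
    { eapply Rle_trans; [apply Cmod_add_INR_upper |].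
      assert (HmJ : (INR J <= INR m)%R) by (apply le_INR; exact Hm).
      assert (Hz : (Cmod z <= INR m * (rho - 1))%R) by nra.
      rewrite S_INR. nra. }
    assert (Hp : (0 <= Cmod (poch z m) * (rho ^ m * INR (fact m)))%R).
    { apply Rmult_le_pos; [apply Cmod_ge_0 |].
      apply Rmult_le_pos; [apply pow_le; lra | apply Rlt_le, INR_fact_lt_0]. }
    pose proof (Rmult_le_compat_l _ _ _ Hp Hle). nra.
Qed.

Lemma poch_lower (c : C) (rho : R) :
  (1 < rho)%R -> Re_not_nonpos_int c ->
  exists K, (0 <= K)%R /\
    forall m, (INR (fact m) <= K * (rho ^ m * Cmod (poch c m)))%R.
Proof.
  intros Hr Hc.
  (* For [m >= J] this choice gives [m + 1 <= rho * (m - Cmod c)]. *)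
  destruct (INR_archimed (rho - 1) (1 + rho * Cmod c) ltac:(lra)) as [J HJ].
  assert (Hg : forall m, (0 < Cmod (poch c m))%R)
    by (intros m; apply Cmod_gt_0, poch_neq_0, Hc).
  apply (dominated_of_ratio (fun m => INR (fact m)) _ J).
  - intros m; apply Rlt_le, INR_fact_lt_0.
  - intros m. apply Rmult_lt_0_compat; [apply pow_lt; lra | apply Hg].
  - intros m Hm. cbn [poch pow]. rewrite Cmod_mult, INR_fact_S.
    assert (Hle : (INR (S m) <= rho * Cmod (c + INR m))%R).
    { pose proof (Cmod_add_INR_lower c m).
      assert (HmJ : (INR J <= INR m)%R) by (apply le_INR; exact Hm).
      assert (Hz : (1 + rho * Cmod c <= INR m * (rho - 1))%R) by nra.
      rewrite S_INR. nra. }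
    assert (Hp : (0 <= INR (fact m) * (rho ^ m * Cmod (poch c m)))%R).
    { apply Rmult_le_pos; [apply Rlt_le, INR_fact_lt_0 |].
      apply Rmult_le_pos; [apply pow_le; lra | apply Cmod_ge_0]. }
    pose proof (Rmult_le_compat_l _ _ _ Hp Hle). nra.
Qed.

Lemma fact_mul_le (m n : nat) : (fact m * fact n <= fact (m + n))%nat.
Proof.
  induction n as [|n IH].
  - rewrite Nat.add_0_r. simpl. lia.
  - rewrite Nat.add_succ_r. change (fact (S n)) with (S n * fact n)%nat.
    change (fact (S (m + n))) with (S (m + n) * fact (m + n))%nat. nia.
Qed.

Lemma sum_n_geom_le (q : R) (N : nat) :
  (0 <= q < 1)%R -> (sum_n (fun n => q ^ n) N <= / (1 - q))%R.
Proof.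
  intros Hq.
  assert (H : (sum_n (fun n => q ^ n) N * (1 - q) = 1 - q ^ S N)%R).
  { induction N as [|N IH].
    - rewrite sum_O. simpl. ring.
    - rewrite sum_Sn.
      change ((sum_n (fun n => q ^ n) N + q ^ S N) * (1 - q) = 1 - q ^ S (S N))%R.
      rewrite Rmult_plus_distr_r, IH. simpl. ring. }
  apply Rmult_le_reg_r with (1 - q)%R; [lra |].
  rewrite H, Rinv_l by lra.
  pose proof (pow_le q (S N) (proj1 Hq)). lra.
Qed.

Lemma abs_summable2_geom (u : nat -> nat -> C) (K p q : R) :
  (0 <= p < 1)%R -> (0 <= q < 1)%R -> (0 <= K)%R ->
  (forall m n, (Cmod (u m n) <= K * (p ^ m * q ^ n))%R) -> abs_summable2 u.
Proof.
  intros Hp Hq HK H. exists (K * (/ (1 - p) * / (1 - q)))%R. intros N.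
  apply Rle_trans with
    (sum_n (fun m => sum_n (fun n => K * (p ^ m * q ^ n)) N) N)%R.
  { apply sum_n_le_compat; intros m. apply sum_n_le_compat; intros n. apply H. }
  apply Rle_trans with (K * (sum_n (fun m => p ^ m) N * sum_n (fun n => q ^ n) N))%R.
  - right. rewrite <- (sum_n_mult_r (K := R_Ring)).
    rewrite <- (sum_n_mult_l (K := R_Ring) K).
    apply sum_n_ext; intros m.
    rewrite <- (sum_n_mult_l (K := R_Ring) (p ^ m)%R).
    rewrite <- (sum_n_mult_l (K := R_Ring) K). reflexivity.
  - apply Rmult_le_compat_l; [exact HK |].
    apply Rmult_le_compat; try (now apply sum_n_geom_le);
      apply sum_n_nonneg; intros k; apply pow_le; lra.
Qed.
(** Two numerators of factorial size over one factorial leave a single [m!], to be absorbed later by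
    [poch c (m + n)]. *)
Lemma poch_mul_div_fact_upper (a b : C) (rho : R) :
  (1 < rho)%R ->
  exists K, (0 <= K)%R /\ forall m,
    (Cmod (poch a m) * Cmod (poch b m) / INR (fact m)
     <= K * (rho ^ m * rho ^ m * INR (fact m)))%R.
Proof.
  intros Hr.
  destruct (poch_upper a rho Hr) as [Ka [HKa Ha]].
  destruct (poch_upper b rho Hr) as [Kb [HKb Hb]].
  exists (Ka * Kb)%R. split; [now apply Rmult_le_pos |]. intros m.
  pose proof (INR_fact_lt_0 m) as Hf.
  apply Rmult_le_reg_r with (INR (fact m)); [exact Hf |].
  unfold Rdiv. rewrite Rmult_assoc, Rinv_l, Rmult_1_r by lra.
  eapply Rle_trans.
  - apply Rmult_le_compat; [apply Cmod_ge_0 | apply Cmod_ge_0 | apply Ha | apply Hb].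
  - right. ring.
Qed.

(* [|(z)_m| <= K rho^m m!] and [N! <= K rho^N |(c)_N|] for every [rho > 1],
   together with [m! n! <= (m + n)!], bound the terms by
   [(rho^3 |x|)^m (rho^3 |y|)^n]. *)
Lemma F3_abs_conv_k_zero (a1 a2 b1 b2 c t1 t2 x y : C) :
  Re_not_nonpos_int c -> (Cmod x < 1)%R -> (Cmod y < 1)%R ->
  F3_abs_conv a1 a2 b1 b2 c t1 t2 0 0 x y.
Proof.
  intros Hc Hx Hy.
  assert (Hrho : exists rho, (1 < rho /\ rho * rho * rho * Cmod x < 1
                              /\ rho * rho * rho * Cmod y < 1)%R).
  { set (M := Rmax (Cmod x) (Cmod y)).
    assert (HxM : (Cmod x <= M)%R) by apply Rmax_l.
    assert (HyM : (Cmod y <= M)%R) by apply Rmax_r.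
    assert (HM : (M < 1)%R) by now apply Rmax_lub_lt.
    pose proof (Cmod_ge_0 x) as Hx0.
    (* With [rho = 1 + e] and [e <= 1/8], [rho^3 <= 1 + 7 e], while [M = 1 - 8 e]; the product
       [(1 + 7 e) * (1 - 8 e)] is below 1. *)
    set (e := ((1 - M) / 8)%R).
    assert (He : (0 < e)%R) by (unfold e; lra).
    assert (HMe : (M = 1 - 8 * e)%R) by (unfold e; lra).
    assert (H3 : ((1 + e) * (1 + e) * (1 + e) <= 1 + 7 * e)%R) by nra.
    assert (H3M : ((1 + e) * (1 + e) * (1 + e) * M < 1)%R) by nra.
    assert (0 <= (1 + e) * (1 + e) * (1 + e))%R by nra.
    exists (1 + e)%R. repeat split; [lra | |];
      (eapply Rle_lt_trans; [apply Rmult_le_compat_l | exact H3M]; assumption). }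
  destruct Hrho as [rho [Hr [Hrx Hry]]].
  destruct (poch_mul_div_fact_upper a1 b1 rho Hr) as [K1 [HK1 H1]].
  destruct (poch_mul_div_fact_upper a2 b2 rho Hr) as [K2 [HK2 H2]].
  destruct (poch_lower c rho Hr Hc) as [K3 [HK3 H3]].
  assert (Hr3 : (0 < rho * rho * rho)%R) by nra.
  apply (abs_summable2_geom _ (K1 * K2 * K3)
           (rho * rho * rho * Cmod x) (rho * rho * rho * Cmod y)).
  - split; [apply Rmult_le_pos; [lra | apply Cmod_ge_0] | exact Hrx].
  - split; [apply Rmult_le_pos; [lra | apply Cmod_ge_0] | exact Hry].
  - apply Rmult_le_pos; [now apply Rmult_le_pos | exact HK3].
  - intros m n. specialize (H1 m). specialize (H2 n). specialize (H3 (m + n)%nat).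
    pose proof (poch_neq_0 c (m + n) Hc) as Nc.
    pose proof (INR_fact_lt_0 m) as Fm. pose proof (INR_fact_lt_0 n) as Fn.
    pose proof (INR_fact_lt_0 (m + n)) as Fmn.
    (* This is the reciprocal of a binomial coefficient. *)
    assert (Hfact : (INR (fact m) * INR (fact n) / INR (fact (m + n)) <= 1)%R).
    { apply Rmult_le_reg_r with (INR (fact (m + n))); [exact Fmn |].
      unfold Rdiv. rewrite Rmult_assoc, Rinv_l, Rmult_1_r, Rmult_1_l by lra.
      rewrite <- mult_INR. apply le_INR, fact_mul_le. }
    pose proof (proj1 (Cmod_gt_0 _) Nc) as Pc.
    assert (Hinv : (/ Cmod (poch c (m + n))
                    <= K3 * (rho ^ m * rho ^ n) / INR (fact (m + n)))%R).
    { apply Rmult_le_reg_r with (Cmod (poch c (m + n)) * INR (fact (m + n)))%R;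
        [now apply Rmult_lt_0_compat |].
      replace (/ Cmod (poch c (m + n)) * (Cmod (poch c (m + n)) * INR (fact (m + n))))%R
        with (INR (fact (m + n))) by (field; lra).
      eapply Rle_trans; [exact H3 |]. rewrite pow_add.
      right. field. lra. }
    assert (E : Cmod (F3_term a1 a2 b1 b2 c t1 t2 0 0 x y m n)
      = (Cmod (poch a1 m) * Cmod (poch b1 m) / INR (fact m)
         * (Cmod (poch a2 n) * Cmod (poch b2 n) / INR (fact n))
         * / Cmod (poch c (m + n)) * (Cmod x ^ m * Cmod y ^ n))%R).
    { unfold F3_term. rewrite !Nat.mul_0_r. cbn [poch Cpow].
      rewrite !Cmod_mult, Cmod_div, !Cmod_mult, !Cmod_1, !Cmod_pow, !Cmod_R.
      - rewrite !Rabs_pos_eq by (apply Rlt_le; assumption). field. lra.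
      - apply Cmod_gt_0. rewrite !Cmod_mult, !Cmod_R, !Rabs_pos_eq by lra.
        apply Rmult_lt_0_compat; [| exact Fn]. now apply Rmult_lt_0_compat. }
    rewrite E.
    assert (P1 : (0 <= Cmod (poch a1 m) * Cmod (poch b1 m) / INR (fact m))%R).
    { apply Rdiv_le_0_compat; [| exact Fm].
      apply Rmult_le_pos; apply Cmod_ge_0. }
    assert (P2 : (0 <= Cmod (poch a2 n) * Cmod (poch b2 n) / INR (fact n))%R).
    { apply Rdiv_le_0_compat; [| exact Fn].
      apply Rmult_le_pos; apply Cmod_ge_0. }
    assert (P3 : (0 <= / Cmod (poch c (m + n)))%R)
      by (apply Rlt_le, Rinv_0_lt_compat, Pc).
    assert (Pxy : (0 <= Cmod x ^ m * Cmod y ^ n)%R)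
      by (apply Rmult_le_pos; apply pow_le, Cmod_ge_0).
    eapply Rle_trans.
    { apply Rmult_le_compat_r; [exact Pxy |].
      apply Rmult_le_compat; [now apply Rmult_le_pos | exact P3 | | exact Hinv].
      apply Rmult_le_compat; [exact P1 | exact P2 | exact H1 | exact H2]. }
    assert (PK : (0 <= K1 * K2 * K3 * ((rho * rho * rho * Cmod x) ^ m
                        * (rho * rho * rho * Cmod y) ^ n))%R).
    { apply Rmult_le_pos; [apply Rmult_le_pos; [now apply Rmult_le_pos | exact HK3] |].
      apply Rmult_le_pos; apply pow_le, Rmult_le_pos;
        try apply Cmod_ge_0; lra. }
    (* The product of the three bounds is exactly the geometric bound times [m! n! / (m + n)!]. *)
    pose proof (Rmult_le_compat_l _ _ _ PK Hfact) as HH.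
    rewrite Rmult_1_r in HH. eapply Rle_trans; [| exact HH].
    right. rewrite !Rpow_mult_distr. field. lra.
Qed.

(** Turns the conditional convergence hypotheses of the theorem into unconditional ones, so that
    later lemmas need no case distinction on [k1] and [k2]. *)
Lemma F3_abs_conv_of_positive_k (a1 a2 b1 b2 c t1 t2 : C) (k1 k2 : nat) (x y : C) :
  Re_not_nonpos_int c -> (Cmod x < 1)%R -> (Cmod y < 1)%R ->
  ((0 < k1 \/ 0 < k2)%nat -> F3_abs_conv a1 a2 b1 b2 c t1 t2 k1 k2 x y) ->
  F3_abs_conv a1 a2 b1 b2 c t1 t2 k1 k2 x y.
Proof.
  intros Hc Hx Hy H.
  destruct k1 as [|k1]; [destruct k2 as [|k2] |].
  - now apply F3_abs_conv_k_zero.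
  - apply H. right. lia.
  - apply H. left. lia.
Qed.

(** * Symmetries of the series and transfer of convergence between parameters *)

Lemma abs_summable2_ext (u v : nat -> nat -> C) :
  (forall m n, u m n = v m n) -> abs_summable2 u -> abs_summable2 v.
Proof.
  intros H. apply abs_summable2_dominated with (K := 1%R).
  intros m n. rewrite H. lra.
Qed.

Lemma abs_summable2_flip (u : nat -> nat -> C) :
  abs_summable2 u -> abs_summable2 (fun m n => u n m).
Proof.
  intros [M HM]. exists M. intros N. rewrite sum_n_switch. apply HM.
Qed.

(** This symmetry is used for terms and for convergence, not for values: [CSeries2] sums in a fixed
    order, and the formulas in [a2] re-index [n] directly through [CSeries2_shift_r]. *)
Lemma F3_term_flip (a1 a2 b1 b2 c t1 t2 : C) (k1 k2 : nat) (x y : C) (m n : nat) :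
  F3_term a1 a2 b1 b2 c t1 t2 k1 k2 x y m n
  = F3_term a2 a1 b2 b1 c t2 t1 k2 k1 y x n m.
Proof.
  unfold F3_term, Cdiv. rewrite (Nat.add_comm n m).
  replace (poch c (m + n) * INR (fact n) * INR (fact m))
    with (poch c (m + n) * INR (fact m) * INR (fact n)) by ring.
  ring.
Qed.

Lemma F3_abs_conv_flip (a1 a2 b1 b2 c t1 t2 : C) (k1 k2 : nat) (x y : C) :
  F3_abs_conv a1 a2 b1 b2 c t1 t2 k1 k2 x y ->
  F3_abs_conv a2 a1 b2 b1 c t2 t1 k2 k1 y x.
Proof.
  intros H. refine (abs_summable2_ext _ _ _ (abs_summable2_flip _ H)).
  intros m n. apply F3_term_flip.
Qed.

Lemma F3_term_swap_ab1 (a1 a2 b1 b2 c t1 t2 : C) (k1 k2 : nat) (x y : C) (m n : nat) :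
  F3_term a1 a2 b1 b2 c t1 t2 k1 k2 x y m n
  = F3_term b1 a2 a1 b2 c t1 t2 k1 k2 x y m n.
Proof. unfold F3_term, Cdiv. ring. Qed.

Lemma F3_swap_ab1 (a1 a2 b1 b2 c t1 t2 : C) (k1 k2 : nat) (x y : C) :
  F3 a1 a2 b1 b2 c t1 t2 k1 k2 x y = F3 b1 a2 a1 b2 c t1 t2 k1 k2 x y.
Proof. apply CSeries2_ext; intros m n. apply F3_term_swap_ab1. Qed.

Lemma F3_abs_conv_swap_ab1 (a1 a2 b1 b2 c t1 t2 : C) (k1 k2 : nat) (x y : C) :
  F3_abs_conv a1 a2 b1 b2 c t1 t2 k1 k2 x y ->
  F3_abs_conv b1 a2 a1 b2 c t1 t2 k1 k2 x y.
Proof. apply abs_summable2_ext; intros m n. apply F3_term_swap_ab1. Qed.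

Lemma F3_abs_conv_between_a1 (a1 a2 b1 b2 c t1 t2 : C) (k1 k2 : nat) (x y : C)
    (d s : nat) :
  (d <= s)%nat ->
  F3_abs_conv a1 a2 b1 b2 c t1 t2 k1 k2 x y ->
  F3_abs_conv (a1 + INR s) a2 b1 b2 c t1 t2 k1 k2 x y ->
  F3_abs_conv (a1 + INR d) a2 b1 b2 c t1 t2 k1 k2 x y.
Proof.
  intros Hds H0 Hs.
  destruct (poch_between a1 d s Hds) as [K HK].
  (* [w] is the general term stripped of its [a1] factor. *)
  pose (w := fun m n : nat =>
    poch a2 n * poch b1 m * poch b2 n
    * RtoC (-1) ^ (m * k1) * poch (- t1) (m * k1)
    * RtoC (-1) ^ (n * k2) * poch (- t2) (n * k2)
    / (poch c (m + n) * INR (fact m) * INR (fact n)) * x ^ m * y ^ n).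
  assert (Hw : forall a m n,
    F3_term a a2 b1 b2 c t1 t2 k1 k2 x y m n = poch a m * w m n)
    by (intros; unfold F3_term, w, Cdiv; ring).
  apply (abs_summable2_ext (fun m n => poch (a1 + INR d) m * w m n));
    [intros; symmetry; apply Hw |].
  apply (abs_summable2_factor (fun m _ => poch (a1 + INR d) m)
           (fun m _ => poch a1 m) (fun m _ => poch (a1 + INR s) m) w K).
  - intros m _. apply HK.
  - exact (abs_summable2_ext _ _ (Hw a1) H0).
  - exact (abs_summable2_ext _ _ (Hw (a1 + INR s)) Hs).
Qed.

Lemma Re_not_nonpos_int_add (c : C) (d : nat) :
  Re_not_nonpos_int c -> Re_not_nonpos_int (c + INR d).
Proof.
  intros H j E. apply (H (j + d)%nat). unfold Re in *. simpl in E. rewrite plus_INR. lra.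
Qed.

Lemma Re_not_nonpos_int_neq_0 (c : C) : Re_not_nonpos_int c -> c <> RtoC 0.
Proof. intros H E. apply (H O). rewrite E. simpl. ring. Qed.

Lemma INR_fact_neq_0_C (n : nat) : RtoC (INR (fact n)) <> RtoC 0.
Proof. intros E. apply (INR_fact_neq_0 n). now injection E. Qed.

Lemma F3_abs_conv_add_c (a1 a2 b1 b2 c t1 t2 : C) (k1 k2 : nat) (x y : C) (d : nat) :
  Re_not_nonpos_int c ->
  F3_abs_conv a1 a2 b1 b2 c t1 t2 k1 k2 x y ->
  F3_abs_conv a1 a2 b1 b2 (c + INR d) t1 t2 k1 k2 x y.
Proof.
  intros Hc H.
  destruct (poch_inv_between c d Hc (Re_not_nonpos_int_add c d Hc)) as [K HK].
  (* [w] is the general term stripped of [poch c (m + n)]. *)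
  pose (w := fun m n : nat =>
    poch a1 m * poch a2 n * poch b1 m * poch b2 n
    * RtoC (-1) ^ (m * k1) * poch (- t1) (m * k1)
    * RtoC (-1) ^ (n * k2) * poch (- t2) (n * k2)
    / (INR (fact m) * INR (fact n)) * x ^ m * y ^ n).
  assert (Hw : forall e m n, Re_not_nonpos_int e ->
    F3_term a1 a2 b1 b2 e t1 t2 k1 k2 x y m n = / poch e (m + n) * w m n).
  { intros e m n He. unfold F3_term, w. field.
    repeat split; try apply INR_fact_neq_0_C. now apply poch_neq_0. }
  refine (abs_summable2_dominated _ _ K _ H). intros m n.
  rewrite !Hw, !Cmod_mult by (assumption || now apply Re_not_nonpos_int_add).
  rewrite <- Rmult_assoc. apply Rmult_le_compat_r; [apply Cmod_ge_0 | apply HK].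
Qed.

(** * Contiguous relations: raising a numerator parameter or lowering [c] by one *)

(** The difference of the [a1] factors is [(m + 1) * poch (a1 + 1) m], and [m + 1] cancels against
    [(m + 1)!]. Splitting off the first factors of the other symbols produces the scalar and the
    shifted parameters. *)
Lemma F3_term_succ_a1 (a1 a2 b1 b2 c t1 t2 : C) (k1 k2 : nat) (x y : C) (m n : nat) :
  Re_not_nonpos_int c ->
  F3_term (a1 + 1) a2 b1 b2 c t1 t2 k1 k2 x y (S m) n
  - F3_term a1 a2 b1 b2 c t1 t2 k1 k2 x y (S m) n
  = RtoC (-1) ^ k1 * poch (- t1) k1 * b1 * x / c
    * F3_term (a1 + 1) a2 (b1 + 1) b2 (c + 1) (t1 - INR k1) t2 k1 k2 x y m n.
Proof.
  intros Hc.
  pose proof (Re_not_nonpos_int_neq_0 c Hc) as Nc.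
  pose proof (poch_neq_0 _ (m + n) (Re_not_nonpos_int_add c 1 Hc)) as Np.
  cbn [INR] in Np.
  assert (NS : RtoC (INR (S m)) <> RtoC 0).
  { intros E. apply (not_0_INR (S m)); [lia | now injection E]. }
  unfold F3_term. rewrite Nat.add_succ_l, (poch_S_l a1), (poch_S_l b1), (poch_S_l c).
  cbn [poch].
  rewrite INR_fact_S, RtoC_mult.
  (* Splitting off the first [k1] factors of [poch (- t1)] leaves a symbol based at [- t1 + k1],
     which replaces [t1] by [t1 - k1]. *)
  replace (S m * k1)%nat with (k1 + m * k1)%nat by lia.
  rewrite poch_add, Cpow_add_r, Cpow_S.
  replace (- (t1 - INR k1)) with (- t1 + INR k1) by ring.
  assert (ES : RtoC (INR (S m)) = INR m + 1) by (rewrite S_INR, RtoC_plus; reflexivity).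
  rewrite ES in *.
  field. repeat split; try assumption; apply INR_fact_neq_0_C.
Qed.

(* [/ (c)_N = (c + N) / (c (c + 1)_N)] with [N = m + n]. *)
Lemma F3_term_pred_c (a1 a2 b1 b2 c t1 t2 : C) (k1 k2 : nat) (x y : C) (m n : nat) :
  Re_not_nonpos_int c ->
  F3_term a1 a2 b1 b2 c t1 t2 k1 k2 x y m n
  = F3_term a1 a2 b1 b2 (c + 1) t1 t2 k1 k2 x y m n
    + (INR m / c * F3_term a1 a2 b1 b2 (c + 1) t1 t2 k1 k2 x y m n
       + INR n / c * F3_term a1 a2 b1 b2 (c + 1) t1 t2 k1 k2 x y m n).
Proof.
  intros Hc.
  pose proof (Re_not_nonpos_int_neq_0 c Hc) as Nc.
  pose proof (poch_neq_0 _ (m + n) Hc) as Np.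
  pose proof (poch_neq_0 _ (m + n) (Re_not_nonpos_int_add c 1 Hc)) as Nq.
  cbn [INR] in Nq.
  assert (Nn : c + (INR m + INR n) <> RtoC 0).
  { rewrite <- RtoC_plus, <- plus_INR.
    apply Re_not_nonpos_int_neq_0, Re_not_nonpos_int_add, Hc. }
  assert (E : poch (c + 1) (m + n) = poch c (m + n) * (c + (INR m + INR n)) / c).
  { pose proof (poch_S_l c (m + n)) as E. cbn [poch] in E.
    rewrite plus_INR, RtoC_plus in E. rewrite E. field. exact Nc. }
  unfold F3_term. rewrite E. field.
  repeat split; try assumption; apply INR_fact_neq_0_C.
Qed.

(** The weight [m + 1] cancels against [(m + 1)!], and the first factors of the symbols in [a1],
    [b1] and [c] come out as [a1 * b1 / c]. *)
Lemma F3_term_mul_m (a1 a2 b1 b2 c t1 t2 : C) (k1 k2 : nat) (x y : C) (m n : nat) :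
  Re_not_nonpos_int c ->
  INR (S m) * F3_term a1 a2 b1 b2 c t1 t2 k1 k2 x y (S m) n
  = RtoC (-1) ^ k1 * poch (- t1) k1 * a1 * b1 * x / c
    * F3_term (a1 + 1) a2 (b1 + 1) b2 (c + 1) (t1 - INR k1) t2 k1 k2 x y m n.
Proof.
  intros Hc.
  pose proof (Re_not_nonpos_int_neq_0 c Hc) as Nc.
  pose proof (poch_neq_0 _ (m + n) (Re_not_nonpos_int_add c 1 Hc)) as Np.
  cbn [INR] in Np.
  assert (NS : RtoC (INR (S m)) <> RtoC 0).
  { intros E. apply (not_0_INR (S m)); [lia | now injection E]. }
  unfold F3_term. rewrite Nat.add_succ_l, (poch_S_l a1), (poch_S_l b1), (poch_S_l c).
  rewrite INR_fact_S, RtoC_mult.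
  replace (S m * k1)%nat with (k1 + m * k1)%nat by lia.
  rewrite poch_add, Cpow_add_r, Cpow_S.
  replace (- (t1 - INR k1)) with (- t1 + INR k1) by ring.
  field. repeat split; try assumption; apply INR_fact_neq_0_C.
Qed.

Lemma CSeries2_sub_eq (u v w : nat -> nat -> C) (k : C) :
  abs_summable2 u -> abs_summable2 v ->
  CSeries2 (fun m n => u m n - v m n) = k * CSeries2 w ->
  CSeries2 u = CSeries2 v + k * CSeries2 w.
Proof.
  intros Hu Hv <-.
  rewrite <- CSeries2_plus; [| exact Hv | now apply abs_summable2_minus].
  apply CSeries2_ext; intros m n. ring.
Qed.

Lemma F3_succ_a1 (a1 a2 b1 b2 c t1 t2 : C) (k1 k2 : nat) (x y : C) :
  Re_not_nonpos_int c ->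
  F3_abs_conv a1 a2 b1 b2 c t1 t2 k1 k2 x y ->
  F3_abs_conv (a1 + 1) a2 b1 b2 c t1 t2 k1 k2 x y ->
  F3 (a1 + 1) a2 b1 b2 c t1 t2 k1 k2 x y
  = F3 a1 a2 b1 b2 c t1 t2 k1 k2 x y
    + RtoC (-1) ^ k1 * poch (- t1) k1 * b1 * x / c
      * F3 (a1 + 1) a2 (b1 + 1) b2 (c + 1) (t1 - INR k1) t2 k1 k2 x y.
Proof.
  intros Hc H0 H1. apply CSeries2_sub_eq; [exact H1 | exact H0 |].
  apply CSeries2_shift_l; [now apply abs_summable2_minus | |].
  (* For [m = 0] the [a1] factor is the empty product in both terms. *)
  - intros n. unfold F3_term. cbn [poch]. ring.
  - intros m n. now apply F3_term_succ_a1.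
Qed.

Lemma F3_succ_a2 (a1 a2 b1 b2 c t1 t2 : C) (k1 k2 : nat) (x y : C) :
  Re_not_nonpos_int c ->
  F3_abs_conv a1 a2 b1 b2 c t1 t2 k1 k2 x y ->
  F3_abs_conv a1 (a2 + 1) b1 b2 c t1 t2 k1 k2 x y ->
  F3 a1 (a2 + 1) b1 b2 c t1 t2 k1 k2 x y
  = F3 a1 a2 b1 b2 c t1 t2 k1 k2 x y
    + RtoC (-1) ^ k2 * poch (- t2) k2 * b2 * y / c
      * F3 a1 (a2 + 1) b1 (b2 + 1) (c + 1) t1 (t2 - INR k2) k1 k2 x y.
Proof.
  intros Hc H0 H1. apply CSeries2_sub_eq; [exact H1 | exact H0 |].
  apply CSeries2_shift_r; [now apply abs_summable2_minus | |].
  - intros m. unfold F3_term. cbn [poch]. ring.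
  - intros m n. rewrite !(F3_term_flip a1). now apply F3_term_succ_a1.
Qed.

(** The weights [m] and [n] are nonnegative and at most [m + n], so no cancellation between the two
    parts can hide a divergence. *)
Lemma abs_summable2_INR_split (u : nat -> nat -> C) :
  abs_summable2 (fun m n => INR (m + n) * u m n) ->
  abs_summable2 (fun m n => INR m * u m n) /\
  abs_summable2 (fun m n => INR n * u m n).
Proof.
  intros H. split; refine (abs_summable2_dominated _ _ 1%R _ H); intros m n;
    rewrite !Cmod_mult, !Cmod_R, !Rabs_pos_eq, Rmult_1_l by apply pos_INR;
    apply Rmult_le_compat_r; try apply Cmod_ge_0; apply le_INR; lia.
Qed.

Lemma F3_pred_c (a1 a2 b1 b2 c t1 t2 : C) (k1 k2 : nat) (x y : C) :
  Re_not_nonpos_int c ->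
  F3_abs_conv a1 a2 b1 b2 c t1 t2 k1 k2 x y ->
  F3 a1 a2 b1 b2 c t1 t2 k1 k2 x y
  = F3 a1 a2 b1 b2 (c + 1) t1 t2 k1 k2 x y
    + (RtoC (-1) ^ k1 * poch (- t1) k1 * a1 * b1 * x
       * (F3 (a1 + 1) a2 (b1 + 1) b2 (c + 2) (t1 - INR k1) t2 k1 k2 x y
          / (c * (c + 1)))
       + RtoC (-1) ^ k2 * poch (- t2) k2 * a2 * b2 * y
         * (F3 a1 (a2 + 1) b1 (b2 + 1) (c + 2) t1 (t2 - INR k2) k1 k2 x y
            / (c * (c + 1)))).
Proof.
  intros Hc H.
  pose proof (Re_not_nonpos_int_neq_0 c Hc) as Nc.
  pose proof (Re_not_nonpos_int_add c 1 Hc) as Hc1.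
  pose proof (F3_abs_conv_add_c _ _ _ _ _ _ _ _ _ _ _ 1 Hc H) as H1.
  cbn [INR] in Hc1, H1.
  pose proof (Re_not_nonpos_int_neq_0 _ Hc1) as Nc1.
  set (T := F3_term a1 a2 b1 b2 (c + 1) t1 t2 k1 k2 x y).
  (* The weighted series is [c] times the difference of the series at [c] and at [c + 1], both
     absolutely convergent. *)
  assert (Hsum : abs_summable2 (fun m n => INR (m + n) * T m n)).
  { apply (abs_summable2_ext (fun m n =>
      c * (F3_term a1 a2 b1 b2 c t1 t2 k1 k2 x y m n - T m n))).
    - intros m n. rewrite F3_term_pred_c by exact Hc. fold T.
      rewrite plus_INR, RtoC_plus. field. exact Nc.
    - apply abs_summable2_scal, abs_summable2_minus; [exact H | exact H1]. }
  destruct (abs_summable2_INR_split T Hsum) as [Hm Hn].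
  assert (HA : abs_summable2 (fun m n => INR m / c * T m n)).
  { refine (abs_summable2_ext _ _ _ (abs_summable2_scal (/ c) _ Hm)).
    intros m n. unfold Cdiv. ring. }
  assert (HB : abs_summable2 (fun m n => INR n / c * T m n)).
  { refine (abs_summable2_ext _ _ _ (abs_summable2_scal (/ c) _ Hn)).
    intros m n. unfold Cdiv. ring. }
  unfold F3 at 1.
  rewrite (CSeries2_ext _ _ (fun m n => F3_term_pred_c a1 a2 b1 b2 c t1 t2 k1 k2 x y m n Hc)).
  fold T.
  rewrite CSeries2_plus; [| exact H1 | now apply abs_summable2_plus].
  rewrite CSeries2_plus by assumption.
  replace (c + 2) with (c + 1 + 1) by ring.
  f_equal. f_equal.
  (* The weight [INR m / c] gives the denominator [c]; [F3_term_mul_m], applied at [c + 1], gives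
     the other one. *)
  - rewrite (CSeries2_shift_l
      (RtoC (-1) ^ k1 * poch (- t1) k1 * a1 * b1 * x / (c * (c + 1))) _
      (F3_term (a1 + 1) a2 (b1 + 1) b2 (c + 1 + 1) (t1 - INR k1) t2 k1 k2 x y) HA).
    + unfold F3, Cdiv. ring.
    + intros n. cbn [INR]. unfold Cdiv. ring.
    + intros m n.
      replace (INR (S m) / c * T (S m) n) with (/ c * (INR (S m) * T (S m) n))
        by (unfold Cdiv; ring).
      unfold T. rewrite F3_term_mul_m by exact Hc1. field. now split.
  - rewrite (CSeries2_shift_r
      (RtoC (-1) ^ k2 * poch (- t2) k2 * a2 * b2 * y / (c * (c + 1))) _
      (F3_term a1 (a2 + 1) b1 (b2 + 1) (c + 1 + 1) t1 (t2 - INR k2) k1 k2 x y) HB).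
    + unfold F3, Cdiv. ring.
    + intros m. cbn [INR]. unfold Cdiv. ring.
    + intros m n.
      replace (INR (S n) / c * T m (S n)) with (/ c * (INR (S n) * T m (S n)))
        by (unfold Cdiv; ring).
      unfold T. rewrite !(F3_term_flip a1), F3_term_mul_m by exact Hc1.
      field. now split.
Qed.

(** * Telescoping to shifts by [s] *)

Lemma sum_n_m_telescope (f h : nat -> C) (s : nat) :
  (forall r, (r < s)%nat -> f (S r) = f r + h (S r)) ->
  f s = f O + sum_n_m h 1 s.
Proof.
  induction s as [|s IH]; intros H.
  - rewrite sum_n_m_zero by lia. symmetry. apply Cplus_0_r.
  - rewrite sum_n_Sm by lia. rewrite H, IH by (intros; try apply H; lia).
    change (plus (sum_n_m h 1 s) (h (S s))) with (sum_n_m h 1 s + h (S s)). ring.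
Qed.

Lemma sum_n_m_Cmult_l (k : C) (h : nat -> C) (i j : nat) :
  sum_n_m (fun r => k * h r) i j = k * sum_n_m h i j.
Proof. exact (sum_n_m_mult_l (K := C_Ring) k h i j). Qed.

Lemma sum_n_m_rev (g : nat -> C) (s : nat) :
  (0 < s)%nat ->
  sum_n_m (fun r => g (s - r)%nat) 1 s = sum_n_m g 0 (s - 1).
Proof.
  destruct s as [|p]; [lia |]. intros _.
  replace (S p - 1)%nat with p by lia.
  rewrite <- (sum_n_m_S (fun r => g (S p - r)%nat) 0 p).
  induction p as [|p IH].
  - now rewrite !sum_n_n.
  - rewrite (sum_n_Sm g) by lia. rewrite <- IH.
    rewrite sum_Sn_m by lia.
    (* The first term of the reversed sum, [g (S p)], is the last term of the other sum. *)
    rewrite <- (sum_n_m_S (fun r => g (S (S p) - S r)%nat) 0 p).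
    apply Cplus_comm.
Qed.

(** Since [a - s + r = a - (s - r)], reversing the index turns an ascent from [a - s] into the
    descent written in the theorem. *)
Lemma sum_n_m_descend (f : C -> C) (a : C) (s : nat) :
  (0 < s)%nat ->
  sum_n_m (fun r => f (a - INR s + INR r)) 1 s
  = sum_n_m (fun r => f (a - INR r)) 0 (s - 1).
Proof.
  intros Hs. rewrite <- (sum_n_m_rev (fun r => f (a - INR r))) by exact Hs.
  apply sum_n_m_ext_loc. intros r Hr.
  rewrite minus_INR, RtoC_minus by lia. f_equal. ring.
Qed.

Lemma F3_add_a1 (a1 a2 b1 b2 c t1 t2 : C) (k1 k2 s : nat) (x y : C) :
  Re_not_nonpos_int c ->
  F3_abs_conv a1 a2 b1 b2 c t1 t2 k1 k2 x y ->
  F3_abs_conv (a1 + INR s) a2 b1 b2 c t1 t2 k1 k2 x y ->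
  F3 (a1 + INR s) a2 b1 b2 c t1 t2 k1 k2 x y
  = F3 a1 a2 b1 b2 c t1 t2 k1 k2 x y
    + RtoC (-1) ^ k1 * poch (- t1) k1 * b1 * x / c
      * sum_n_m (fun r : nat =>
          F3 (a1 + INR r) a2 (b1 + 1) b2 (c + 1) (t1 - INR k1) t2 k1 k2 x y) 1 s.
Proof.
  intros Hc H0 Hs. rewrite <- sum_n_m_Cmult_l.
  replace (F3 a1 a2 b1 b2 c t1 t2 k1 k2 x y)
    with (F3 (a1 + INR 0) a2 b1 b2 c t1 t2 k1 k2 x y)
    by (cbn [INR]; now rewrite Cplus_0_r).
  apply (sum_n_m_telescope (fun r => F3 (a1 + INR r) a2 b1 b2 c t1 t2 k1 k2 x y)).
  intros r Hr.
  assert (E : a1 + INR (S r) = a1 + INR r + 1)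
    by (rewrite S_INR, RtoC_plus; ring).
  (* Both [r] and [S r] lie between 0 and [s], so convergence at the two endpoints suffices. *)
  rewrite E. apply F3_succ_a1; [exact Hc | |]; [| rewrite <- E];
    apply F3_abs_conv_between_a1 with s; assumption || lia.
Qed.

Lemma F3_add_a2 (a1 a2 b1 b2 c t1 t2 : C) (k1 k2 s : nat) (x y : C) :
  Re_not_nonpos_int c ->
  F3_abs_conv a1 a2 b1 b2 c t1 t2 k1 k2 x y ->
  F3_abs_conv a1 (a2 + INR s) b1 b2 c t1 t2 k1 k2 x y ->
  F3 a1 (a2 + INR s) b1 b2 c t1 t2 k1 k2 x y
  = F3 a1 a2 b1 b2 c t1 t2 k1 k2 x y
    + RtoC (-1) ^ k2 * poch (- t2) k2 * b2 * y / c
      * sum_n_m (fun r : nat =>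
          F3 a1 (a2 + INR r) b1 (b2 + 1) (c + 1) t1 (t2 - INR k2) k1 k2 x y) 1 s.
Proof.
  intros Hc H0 Hs. rewrite <- sum_n_m_Cmult_l.
  replace (F3 a1 a2 b1 b2 c t1 t2 k1 k2 x y)
    with (F3 a1 (a2 + INR 0) b1 b2 c t1 t2 k1 k2 x y)
    by (cbn [INR]; now rewrite Cplus_0_r).
  apply (sum_n_m_telescope (fun r => F3 a1 (a2 + INR r) b1 b2 c t1 t2 k1 k2 x y)).
  intros r Hr.
  assert (E : a2 + INR (S r) = a2 + INR r + 1)
    by (rewrite S_INR, RtoC_plus; ring).
  (* Exchanging the two indices makes the interpolation of convergence in the first parameter
     available for [a2]. *)
  rewrite E. apply F3_abs_conv_flip in H0. apply F3_abs_conv_flip in Hs.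
  apply F3_succ_a2; [exact Hc | |]; [| rewrite <- E];
    apply F3_abs_conv_flip, F3_abs_conv_between_a1 with s; assumption || lia.
Qed.

(** This is the ascending formula started at [a1 - s], solved for its starting value. *)
Lemma F3_sub_a1 (a1 a2 b1 b2 c t1 t2 : C) (k1 k2 s : nat) (x y : C) :
  Re_not_nonpos_int c -> (0 < s)%nat ->
  F3_abs_conv a1 a2 b1 b2 c t1 t2 k1 k2 x y ->
  F3_abs_conv (a1 - INR s) a2 b1 b2 c t1 t2 k1 k2 x y ->
  F3 (a1 - INR s) a2 b1 b2 c t1 t2 k1 k2 x y
  = F3 a1 a2 b1 b2 c t1 t2 k1 k2 x y
    - RtoC (-1) ^ k1 * poch (- t1) k1 * b1 * x / c
      * sum_n_m (fun r : nat =>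
          F3 (a1 - INR r) a2 (b1 + 1) b2 (c + 1) (t1 - INR k1) t2 k1 k2 x y) 0 (s - 1).
Proof.
  intros Hc Hs H0 H1.
  assert (E : a1 - INR s + INR s = a1) by ring.
  pose proof (F3_add_a1 (a1 - INR s) a2 b1 b2 c t1 t2 k1 k2 s x y Hc H1) as H.
  rewrite E in H. specialize (H H0).
  rewrite (sum_n_m_descend
    (fun a => F3 a a2 (b1 + 1) b2 (c + 1) (t1 - INR k1) t2 k1 k2 x y)) in H by exact Hs.
  rewrite H. ring.
Qed.

Lemma F3_sub_a2 (a1 a2 b1 b2 c t1 t2 : C) (k1 k2 s : nat) (x y : C) :
  Re_not_nonpos_int c -> (0 < s)%nat ->
  F3_abs_conv a1 a2 b1 b2 c t1 t2 k1 k2 x y ->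
  F3_abs_conv a1 (a2 - INR s) b1 b2 c t1 t2 k1 k2 x y ->
  F3 a1 (a2 - INR s) b1 b2 c t1 t2 k1 k2 x y
  = F3 a1 a2 b1 b2 c t1 t2 k1 k2 x y
    - RtoC (-1) ^ k2 * poch (- t2) k2 * b2 * y / c
      * sum_n_m (fun r : nat =>
          F3 a1 (a2 - INR r) b1 (b2 + 1) (c + 1) t1 (t2 - INR k2) k1 k2 x y) 0 (s - 1).
Proof.
  intros Hc Hs H0 H1.
  assert (E : a2 - INR s + INR s = a2) by ring.
  pose proof (F3_add_a2 a1 (a2 - INR s) b1 b2 c t1 t2 k1 k2 s x y Hc H1) as H.
  rewrite E in H. specialize (H H0).
  rewrite (sum_n_m_descend
    (fun a => F3 a1 a b1 (b2 + 1) (c + 1) t1 (t2 - INR k2) k1 k2 x y)) in H by exact Hs.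
  rewrite H. ring.
Qed.

(** Each telescoping step lowers [c] by one. All denominator parameters met on the way are [c - s]
    plus a natural number, so admissibility and convergence spread upwards from [c - s]. *)
Lemma F3_sub_c (a1 a2 b1 b2 c t1 t2 : C) (k1 k2 s : nat) (x y : C) :
  Re_not_nonpos_int (c - INR s) ->
  F3_abs_conv a1 a2 b1 b2 (c - INR s) t1 t2 k1 k2 x y ->
  F3 a1 a2 b1 b2 (c - INR s) t1 t2 k1 k2 x y
  = F3 a1 a2 b1 b2 c t1 t2 k1 k2 x y
    + RtoC (-1) ^ k1 * poch (- t1) k1 * a1 * b1 * x
      * sum_n_m (fun r : nat =>
          F3 (a1 + 1) a2 (b1 + 1) b2 (c + 2 - INR r) (t1 - INR k1) t2 k1 k2 x y
          / ((c - INR r) * (c - INR r + 1))) 1 s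
    + RtoC (-1) ^ k2 * poch (- t2) k2 * a2 * b2 * y
      * sum_n_m (fun r : nat =>
          F3 a1 (a2 + 1) b1 (b2 + 1) (c + 2 - INR r) t1 (t2 - INR k2) k1 k2 x y
          / ((c - INR r) * (c - INR r + 1))) 1 s.
Proof.
  intros Hc H.
  rewrite <- !sum_n_m_Cmult_l, <- Cplus_assoc.
  match goal with |- _ = _ + (?S1 + ?S2) => change (S1 + S2) with (plus S1 S2) end.
  rewrite <- (sum_n_m_plus (G := C_AbelianMonoid)).
  replace (F3 a1 a2 b1 b2 c t1 t2 k1 k2 x y)
    with (F3 a1 a2 b1 b2 (c - INR 0) t1 t2 k1 k2 x y)
    by (cbn [INR]; f_equal; ring).
  apply (sum_n_m_telescope (fun r => F3 a1 a2 b1 b2 (c - INR r) t1 t2 k1 k2 x y)).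
  intros r Hr.
  assert (E0 : c - INR (S r) = c - INR s + INR (s - S r))
    by (rewrite minus_INR, RtoC_minus by lia; ring).
  assert (E1 : c - INR r = c - INR (S r) + 1)
    by (rewrite S_INR, RtoC_plus; ring).
  rewrite E1. replace (c + 2 - INR (S r)) with (c - INR (S r) + 2) by ring.
  apply F3_pred_c; rewrite E0.
  - now apply Re_not_nonpos_int_add.
  - now apply F3_abs_conv_add_c.
Qed.

(** * Assembly of the seven recursion formulas *)

Theorem theorem5p1 (a1 a2 b1 b2 c t1 t2 : C) (k1 k2 s : nat) (x y : C)
    (Hc : Re_not_nonpos_int c) (Hs : (0 < s)%nat)
    (Hx : (Cmod x < 1)%R) (Hy : (Cmod y < 1)%R)
    (Hconv : (0 < k1 \/ 0 < k2)%nat ->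
       F3_abs_conv a1 a2 b1 b2 c t1 t2 k1 k2 x y) :
  (((0 < k1 \/ 0 < k2)%nat ->
     F3_abs_conv (a1 + INR s) a2 b1 b2 c t1 t2 k1 k2 x y) ->
   F3 (a1 + INR s) a2 b1 b2 c t1 t2 k1 k2 x y
   = F3 a1 a2 b1 b2 c t1 t2 k1 k2 x y
     + RtoC (-1) ^ k1 * poch (- t1) k1 * b1 * x / c
       * sum_n_m (fun r : nat =>
           F3 (a1 + INR r) a2 (b1 + 1) b2 (c + 1) (t1 - INR k1) t2 k1 k2 x y) 1 s)
  /\
  (((0 < k1 \/ 0 < k2)%nat ->
     F3_abs_conv (a1 - INR s) a2 b1 b2 c t1 t2 k1 k2 x y) ->
   F3 (a1 - INR s) a2 b1 b2 c t1 t2 k1 k2 x y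
   = F3 a1 a2 b1 b2 c t1 t2 k1 k2 x y
     - RtoC (-1) ^ k1 * poch (- t1) k1 * b1 * x / c
       * sum_n_m (fun r : nat =>
           F3 (a1 - INR r) a2 (b1 + 1) b2 (c + 1) (t1 - INR k1) t2 k1 k2 x y) 0 (s - 1))
  /\
  (((0 < k1 \/ 0 < k2)%nat ->
     F3_abs_conv a1 (a2 + INR s) b1 b2 c t1 t2 k1 k2 x y) ->
   F3 a1 (a2 + INR s) b1 b2 c t1 t2 k1 k2 x y
   = F3 a1 a2 b1 b2 c t1 t2 k1 k2 x y
     + RtoC (-1) ^ k2 * poch (- t2) k2 * b2 * y / c
       * sum_n_m (fun r : nat =>
           F3 a1 (a2 + INR r) b1 (b2 + 1) (c + 1) t1 (t2 - INR k2) k1 k2 x y) 1 s)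
  /\
  (((0 < k1 \/ 0 < k2)%nat ->
     F3_abs_conv a1 (a2 - INR s) b1 b2 c t1 t2 k1 k2 x y) ->
   F3 a1 (a2 - INR s) b1 b2 c t1 t2 k1 k2 x y
   = F3 a1 a2 b1 b2 c t1 t2 k1 k2 x y
     - RtoC (-1) ^ k2 * poch (- t2) k2 * b2 * y / c
       * sum_n_m (fun r : nat =>
           F3 a1 (a2 - INR r) b1 (b2 + 1) (c + 1) t1 (t2 - INR k2) k1 k2 x y) 0 (s - 1))
  /\
  (((0 < k1 \/ 0 < k2)%nat ->
     F3_abs_conv a1 a2 (b1 + INR s) b2 c t1 t2 k1 k2 x y) ->
   F3 a1 a2 (b1 + INR s) b2 c t1 t2 k1 k2 x y
   = F3 a1 a2 b1 b2 c t1 t2 k1 k2 x y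
     + RtoC (-1) ^ k1 * poch (- t1) k1 * a1 * x / c
       * sum_n_m (fun r : nat =>
           F3 (a1 + 1) a2 (b1 + INR r) b2 (c + 1) (t1 - INR k1) t2 k1 k2 x y) 1 s)
  /\
  (((0 < k1 \/ 0 < k2)%nat ->
     F3_abs_conv a1 a2 (b1 - INR s) b2 c t1 t2 k1 k2 x y) ->
   F3 a1 a2 (b1 - INR s) b2 c t1 t2 k1 k2 x y
   = F3 a1 a2 b1 b2 c t1 t2 k1 k2 x y
     - RtoC (-1) ^ k1 * poch (- t1) k1 * a1 * x / c
       * sum_n_m (fun r : nat =>
           F3 (a1 + 1) a2 (b1 - INR r) b2 (c + 1) (t1 - INR k1) t2 k1 k2 x y) 0 (s - 1))
  /\
  (Re_not_nonpos_int (c - INR s) ->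
   ((0 < k1 \/ 0 < k2)%nat ->
     F3_abs_conv a1 a2 b1 b2 (c - INR s) t1 t2 k1 k2 x y) ->
   F3 a1 a2 b1 b2 (c - INR s) t1 t2 k1 k2 x y
   = F3 a1 a2 b1 b2 c t1 t2 k1 k2 x y
     + RtoC (-1) ^ k1 * poch (- t1) k1 * a1 * b1 * x
       * sum_n_m (fun r : nat =>
           F3 (a1 + 1) a2 (b1 + 1) b2 (c + 2 - INR r) (t1 - INR k1) t2 k1 k2 x y
           / ((c - INR r) * (c - INR r + 1))) 1 s
     + RtoC (-1) ^ k2 * poch (- t2) k2 * a2 * b2 * y
       * sum_n_m (fun r : nat =>
           F3 a1 (a2 + 1) b1 (b2 + 1) (c + 2 - INR r) t1 (t2 - INR k2) k1 k2 x y
           / ((c - INR r) * (c - INR r + 1))) 1 s).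
Proof.
  pose proof (F3_abs_conv_of_positive_k _ _ _ _ _ _ _ _ _ _ _ Hc Hx Hy Hconv) as H0.
  repeat split.
  - intros H1. apply F3_abs_conv_of_positive_k in H1; try assumption.
    now apply F3_add_a1.
  - intros H1. apply F3_abs_conv_of_positive_k in H1; try assumption.
    now apply F3_sub_a1.
  - intros H1. apply F3_abs_conv_of_positive_k in H1; try assumption.
    now apply F3_add_a2.
  - intros H1. apply F3_abs_conv_of_positive_k in H1; try assumption.
    now apply F3_sub_a2.
  - intros H1. apply F3_abs_conv_of_positive_k in H1; try assumption.
    (* Exchanging [a1] with [b1] everywhere, also under the finite sum, reduces the claim to the
       formula in [a1]. *)
    rewrite !(F3_swap_ab1 a1).
    rewrite (sum_n_m_ext _ _ _ _ (fun r => F3_swap_ab1 (a1 + 1) _ _ _ _ _ _ _ _ _ _)).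
    apply F3_add_a1; [exact Hc | |]; now apply F3_abs_conv_swap_ab1.
  - intros H1. apply F3_abs_conv_of_positive_k in H1; try assumption.
    rewrite !(F3_swap_ab1 a1).
    rewrite (sum_n_m_ext _ _ _ _ (fun r => F3_swap_ab1 (a1 + 1) _ _ _ _ _ _ _ _ _ _)).
    apply F3_sub_a1; [exact Hc | exact Hs | |]; now apply F3_abs_conv_swap_ab1.
  - intros Hcs H1. apply F3_abs_conv_of_positive_k in H1; try assumption.
    now apply F3_sub_c.
Qed.
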